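(* Let $X$ and $Y$ be mm-spaces. Then \[ \square(X,Y)=\min_{\pi,S}\max\{1-\pi(S),\ \operatorname{dis} S\}, \] where $\pi$ runs over all transport plans $\pi\in\Pi(m_X,m_Y)$ and $S$ runs over all closed subsets of $X\times Y$; in particular the minimum is attained by some pair $(\pi,S)$.
   Context: An mm-space is a triple $(X,d_X,m_X)$ where $(X,d_X)$ is a complete separable metric space and $m_X$ is a Borel probability measure on $X$. For Borel probability measures $\mu,\nu$ on $X,Y$, $\Pi(\mu,\nu)$ denotes the set of Borel probability measures $\pi$ on $X\times Y$ with $(\mathrm{pr}_1)_*\pi=\mu$ and $(\mathrm{pr}_2)_*\pi=\nu$ (transport plans). For a nonempty $S\subset X\times Y$, $\operatorname{dis}S:=\sup\{|d_X(x,x')-d_Y(y,y')| : (x,y),(x',y')\in S\}$, and $\operatorname{dis}\emptyset:=\infty$. Let $I=[0,1)$ with Lebesgue measure $\mathcal L^1$. A parameter of $X$ is a Borel map $\varphi:I\to X$ with $\varphi_*\mathcal L^1=m_X$. For pseudo-metrics $\rho_1,\rho_2$ on $I$, $\square(\rho_1,\rho_2)$ is the infimum of $\varepsilon\ge0$ such that there is a Borel $I_0\subset I$ with $\mathcal L^1(I_0)\ge1-\varepsilon$ and $|\rho_1(s,t)-\rho_2(s,t)|\le\varepsilon$ for all $s,t\in I_0$. The box distance is $\square(X,Y):=\inf_{\varphi,\psi}\square(\varphi^*d_X,\psi^*d_Y)$ over parameters $\varphi$ of $X$ and $\psi$ of $Y$, where $\varphi^*d_X(s,t):=d_X(\varphi(s),\varphi(t))$.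 *)

(* Defs.v *)
From HB Require Import structures.
From mathcomp Require Import all_boot all_order all_algebra.
From mathcomp Require Import all_classical all_reals all_analysis.
Set Implicit Arguments. Unset Strict Implicit. Unset Printing Implicit Defensive.
Import Order.TTheory GRing.Theory Num.Theory.
Local Open Scope classical_set_scope.
Local Open Scope ring_scope.

Section Defs.
Context {R : realType}.

Definition is_metric {T : Type} (d : T -> T -> R) : Prop :=
  (forall x y, d x y = 0 <-> x = y) /\
  (forall x y, d x y = d y x) /\
  (forall x y z, d x z <= d x y + d y z).

Definition dball {T : Type} (d : T -> T -> R) (x : T) (e : R) : set T :=
  [set y | d x y < e].

Definition dopen {T : Type} (d : T -> T -> R) (U : set T) : Prop :=
  forall x, U x -> exists2 e : R, 0 < e & dball d x e `<=` U.

Definition dclosed {T : Type} (d : T -> T -> R) (S : set T) : Prop :=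
  dopen d (~` S).

Definition dcauchy {T : Type} (d : T -> T -> R) (u : nat -> T) : Prop :=
  forall e : R, 0 < e -> exists N : nat, forall m n : nat,
    (N <= m)%N -> (N <= n)%N -> d (u m) (u n) < e.

Definition dcomplete {T : Type} (d : T -> T -> R) : Prop :=
  forall u : nat -> T, dcauchy d u ->
    exists x : T, forall e : R, 0 < e -> exists N : nat,
      forall n : nat, (N <= n)%N -> d (u n) x < e.

Definition dseparable {T : Type} (d : T -> T -> R) : Prop :=
  exists D : set T, countable D /\
    forall x (e : R), 0 < e -> exists2 y, D y & d x y < e.

Definition complete_separable_metric {T : Type} (d : T -> T -> R) : Prop :=
  [/\ is_metric d, dcomplete d & dseparable d].

Definition Borel {T : pointedType} (d : T -> T -> R) :=
  g_sigma_algebraType (dopen d).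

(* The (max) product metric on X * Y; it induces the product topology. *)
Definition dprod {X Y : Type} (dX : X -> X -> R) (dY : Y -> Y -> R)
  (p q : X * Y) : R := Num.max (dX p.1 q.1) (dY p.2 q.2).

Definition transport_plan {X Y : pointedType}
    (dX : X -> X -> R) (dY : Y -> Y -> R)
    (mX : probability (Borel dX) R) (mY : probability (Borel dY) R)
    (pi : probability (Borel (dprod dX dY)) R) : Prop :=
  (forall A : set (Borel dX), measurable A ->
      pi ((A `*` [set: Y]) : set (Borel (dprod dX dY))) = mX A) /\
  (forall B : set (Borel dY), measurable B ->
      pi (([set: X] `*` B) : set (Borel (dprod dX dY))) = mY B).

Definition dis {X Y : Type} (dX : X -> X -> R) (dY : Y -> Y -> R)
    (S : set (X * Y)) : \bar R :=
  if `[< S = set0 >] then +oo%E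
  else ereal_sup [set (`| dX p.1 q.1 - dY p.2 q.2 |)%:E
                  | p in S & q in S].

Definition unitI : set (measurableTypeR R) := `[0%R, 1%R[.

(* phi : I -> X, represented by a function on R whose values outside I are
   irrelevant; Borel map on I with phi_* L^1 = m_X. *)
Definition parameter {X : pointedType} (dX : X -> X -> R)
    (mX : probability (Borel dX) R) (phi : measurableTypeR R -> Borel dX) :
    Prop :=
  measurable_fun unitI phi /\
  forall A : set (Borel dX), measurable A ->
    lebesgue_measure (unitI `&` phi @^-1` A) = mX A.

Definition box_pm (rho1 rho2 : R -> R -> R) : \bar R :=
  ereal_inf [set e%:E | e in
    [set e : R | 0 <= e /\
      exists I0 : set (measurableTypeR R),
        [/\ measurable I0, I0 `<=` unitI,
            ((1 - e)%:E <= lebesgue_measure I0)%E &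
            forall s t, I0 s -> I0 t -> `| rho1 s t - rho2 s t | <= e]]].

Definition box {X Y : pointedType} (dX : X -> X -> R) (dY : Y -> Y -> R)
    (mX : probability (Borel dX) R) (mY : probability (Borel dY) R) : \bar R :=
  ereal_inf [set box_pm (fun s t => dX (phi s) (phi t))
                        (fun s t => dY (psi s) (psi t))
            | phi in parameter mX & psi in parameter mY].

End Defs.

(* Main.v *)
(* The inequality box <= max (1 - pi S, dis S) holds because every plan [pi] is
   the image of Lebesgue measure under a pair of parameters. Conversely, take
   parameters [phi_n, psi_n] and sets [I_n] that are almost optimal for the box
   distance. Along a non-principal ultrafilter the laws of [(phi_n, psi_n)]
   converge setwise to a finitely additive law with the right marginals, and [S]
   is the set of points all of whose neighbourhoods meet the image of [I_n] for
   almost all [n]. No tightness argument is needed to recover countable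
   additivity: a point of X (or Y) is coded, through a countable base, by a
   sequence of bits, and any finitely additive law of infinitely many bits is
   realized on [0, 1) by nested half-open intervals. Decoding these bits gives
   new parameters whose joint law agrees with the finitely additive one on
   finite unions of basic rectangles, which suffices to bound the mass of the
   open complement of [S]. *)
Require Import Defs.
From HB Require Import structures.
From mathcomp Require Import all_boot all_order all_algebra.
From mathcomp Require Import all_classical all_reals all_analysis.
From mathcomp Require Import lra.
Set Implicit Arguments. Unset Strict Implicit. Unset Printing Implicit Defensive.
Import Order.TTheory GRing.Theory Num.Theory.
Import numFieldNormedType.Exports.
Local Open Scope classical_set_scope.
Local Open Scope ring_scope.

(** * Bit sequences *)

Definition determined (n : nat) (F : set (nat -> bool)) : Prop :=
  forall b b', (forall i, (i < n)%N -> b i = b' i) -> F b -> F b'.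

(** By compactness these are exactly the clopen subsets of Cantor space. *)
Definition clopen : set (set (nat -> bool)) :=
  [set F | exists n, determined n F].

Definition bitspace := g_sigma_algebraType clopen.

Lemma determinedW m n F : (m <= n)%N -> determined m F -> determined n F.
Proof.
move=> mn dF b b' bb'; apply: dF => i im.
by apply: bb'; rewrite (leq_trans im mn).
Qed.

Lemma clopen_setI : setI_closed clopen.
Proof.
move=> F G [m dF] [n dG]; exists (maxn m n) => b b' bb' [Fb Gb]; split.
- by apply: (determinedW (leq_maxl m n) dF) bb' Fb.
- by apply: (determinedW (leq_maxr m n) dG) bb' Gb.
Qed.

Lemma clopen_coord (i : nat) : clopen [set b : nat -> bool | b i].
Proof. by exists i.+1 => b b' bb' /=; rewrite bb'. Qed.

(** Induction on [n]: the value of the last bit splits [F] into two sections, and each section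
    depends only on the earlier bits. *)
Lemma determined_preimage d (T : measurableType d) (f : T -> nat -> bool) :
  (forall i, measurable [set t | f t i]) ->
  forall n F, determined n F -> measurable (f @^-1` F).
Proof.
move=> mf; elim=> [|n IHn] F dF.
  have [[b Fb]|F0] := pselect (exists b, F b).
    rewrite (_ : _ @^-1` _ = setT); first exact: measurableT.
    by apply/seteqP; split => // t _; apply: dF Fb.
  rewrite (_ : _ @^-1` _ = set0); first exact: measurable0.
  by apply/seteqP; split => // t Ft; apply: F0; exists (f t).
pose upd c (b : nat -> bool) i := if i == n then c else b i.
have dG c : determined n [set b | F (upd c b)].
  move=> b b' bb'; apply: dF => i; rewrite ltnS leq_eqVlt /upd.
  by case: eqP => //= _; apply: bb'.
have FE c b : b n = c -> F b <-> F (upd c b).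
  by move=> bn; split; apply: (dF) => i _; rewrite /upd; case: (eqVneq i n) => [->|].
rewrite (_ : _ @^-1` _ =
  ([set t | f t n] `&` (f @^-1` [set b | F (upd true b)])) `|`
  (~` [set t | f t n] `&` (f @^-1` [set b | F (upd false b)]))).
  apply: measurableU; apply: measurableI.
  - exact: mf.
  - exact: IHn (dG true).
  - exact/measurableC/mf.
  - exact: IHn (dG false).
apply/seteqP; split => t /=.
- move=> Ft; case fn : (f t n); [left|right]; split => //; exact/(FE _ _ fn).
- case=> [[fn Ft]|[/negP/negbTE fn Ft]]; exact/(FE _ _ fn).
Qed.

Lemma measurable_bitsP d (T : measurableType d) (f : T -> bitspace) :
  (forall i, measurable [set t | f t i]) -> measurable_fun setT f.
Proof.
move=> mf; apply: (@measurability _ _ _ _ setT f clopen erefl) => _ [F [n dF] <-].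
by rewrite setTI; apply: determined_preimage dF.
Qed.

Lemma measurable_coord i : measurable [set b : bitspace | b i].
Proof. by apply: sub_sigma_algebra; apply: clopen_coord. Qed.

(** The clopen sets form a pi-system that generates the sigma-algebra of [bitspace]. *)
Lemma probability_eq_clopen (R : realType)
    (m1 m2 : probability bitspace R) :
  (forall F, clopen F -> m1 F = m2 F) ->
  forall F : set bitspace, measurable F -> m1 F = m2 F.
Proof.
move=> m12; apply: (@measure_unique _ R bitspace clopen (fun=> setT) erefl
  clopen_setI _ _ m1 m2 m12).
- by move=> _; exists 0%N.
- exact: bigcup_const.
- by move=> _; rewrite ltey_eq fin_num_measure.
Qed.

(** * Coding points by bits *)

(** The second clause makes [A] a base of the topology. It speaks of diameters so that smallness of
    [A n] can be read off from the index alone. *)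
Definition small_base (R : realType) (X : Type) (d : X -> X -> R)
    (A : nat -> set X) : Prop :=
  (forall n, dopen d (A n)) /\
  (forall x (e : R), 0 < e ->
    exists2 n, A n x & forall y z, A n y -> A n z -> d y z < e).

Section Metric.
Variables (R : realType) (X : Type) (d : X -> X -> R).
Hypothesis dm : is_metric d.

Let dxx x : d x x = 0. Proof. by apply/(proj1 dm). Qed.
Let dC x y : d x y = d y x. Proof. by case: dm => _ [+ _]; apply. Qed.
Let dtri x y z : d x z <= d x y + d y z.
Proof. by case: dm => _ [_ +]; apply. Qed.

Lemma dball_dopen x e : dopen d (dball d x e).
Proof.
move=> y /= dxy; exists (e - d x y); first by rewrite subr_gt0.
by move=> z /=; rewrite /dball/= => dyz; have := dtri x y z; lra.
Qed.

Lemma metric_ge0 x y : 0 <= d x y.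
Proof. by have := dtri x y x; rewrite dxx (dC y x); lra. Qed.

(** The base consists of the balls of radius [1 / (k + 1)] about the points of a countable dense
    set. Numbers that code no pair [(i, k)] give the empty set. *)
Lemma exists_small_base : dseparable d -> exists A, small_base d A.
Proof.
move=> [D [/countable_injP[f finj] dD]].
pose A n := if @unpickle (nat * nat)%type n is Some (i, k)
  then [set x | exists2 y, D y & f y = i /\ d y x < k.+1%:R^-1] else set0.
exists A; split=> [n|x e e0].
  rewrite /A; case: unpickle => [[i k]|] // x [y Dy [fy dyx]].
  have [r r0 rA] := @dball_dopen y k.+1%:R^-1 x dyx.
  by exists r => // z /rA dyz; exists y.
have e20 : 0 < e / 2 by lra.
have [k ke] : exists k : nat, k.+1%:R^-1 < e / 2.
  have := near_infty_natSinv_lt (PosNum e20).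
  by move=> [k _ /(_ k (leqnn k))] ke; exists k.
have [y Dy dxy] := dD x k.+1%:R^-1 ltac:(by rewrite invr_gt0).
exists (pickle (f y, k)); rewrite /A pickleK; first by exists y; rewrite // dC.
move=> z1 z2 [y1 Dy1 [fy1 d1]] [y2 Dy2 [fy2 d2]].
have E1 : y1 = y by apply: finj; rewrite ?inE.
have E2 : y2 = y by apply: finj; rewrite ?inE.
subst y1 y2; have := dtri z1 y z2; rewrite (dC z1 y).
by move: (k.+1%:R^-1) ke d1 d2 => c; lra.
Qed.

End Metric.

Definition first (p : pred nat) (n0 : nat) : nat :=
  if pselect (exists n, p n) is left ex then ex_minn ex else n0.

Lemma first_ind (P : nat -> Prop) (p : pred nat) n0 :
  (forall n, p n -> P n) -> ((forall n, ~~ p n) -> P n0) -> P (first p n0).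
Proof.
move=> Pp Pn; rewrite /first; case: pselect => [ex|nex].
  by case: ex_minnP => m pm _; apply: Pp.
by apply: Pn => n; apply/negP => pn; apply: nex; exists n.
Qed.

Lemma measurable_first (Q : pred nat) (n0 m : nat) :
  measurable [set b : bitspace | first (fun n => b n && Q n) n0 = m].
Proof.
pose C n := [set b : bitspace | b n && Q n].
have mC n : measurable (C n).
  rewrite /C; case: (Q n).
    rewrite (_ : [set _ | _] = [set b : bitspace | b n]); first exact: measurable_coord.
    by apply/seteqP; split=> b /=; rewrite andbT.
  rewrite (_ : [set _ | _] = set0); first exact: measurable0.
  by apply/seteqP; split=> b //=; rewrite andbF.
(* Either [m] is the first success, or nothing succeeds and the default [n0] is [m]. *)
rewrite (_ : [set _ | _] = (C m `&` \bigcap_(j in [set j | (j < m)%N]) ~` C j) `|`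
   ((if n0 == m then setT else set0) `&` \bigcap_j ~` C j)).
  apply: measurableU; apply: measurableI.
  - exact: mC.
  - by apply: bigcap_measurableType => j _; apply: measurableC.
  - by case: ifP => _; [apply: measurableT|apply: measurable0].
  - by apply: bigcap_measurableType => j _; apply: measurableC.
apply/seteqP; split=> b /=.
- rewrite /first; case: pselect => [ex|nex] => [|->].
    case: ex_minnP => k Ck kmin <-; left; split => // j /= jk Cj.
    by have := kmin _ Cj; rewrite leqNgt jk.
  by right; rewrite eqxx; split => // j _ Cj; apply: nex; exists j.
- rewrite /first; case: pselect => [ex|nex].
    case: ex_minnP => k Ck kmin [[Cm Cj]|[_ Cj]]; last by case: (Cj k).
    apply/eqP; rewrite eqn_leq kmin //= leqNgt; apply/negP => km.
    exact: (Cj k).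
  case=> [[Cm _]|[]]; first by case: nex; exists m.
  by case: eqP.
Qed.

Lemma exists_halving (R : realType) (e : R) : 0 < e -> exists k, 2^-1 ^+ k < e.
Proof.
move=> e0; have := @cvg_geometric R 1 2^-1.
rewrite ger0_norm ?invr_ge0// invf_lt1// ltr1n => /(_ isT) /cvgrPdist_lt.
move=> /(_ e e0) [k _ /(_ k (leqnn k))] /=.
rewrite sub0r normrN mul1r ger0_norm; first by exists k.
by rewrite exprn_ge0 // invr_ge0.
Qed.

Lemma le_halving (R : realType) (x : R) (c : R) :
  (forall k, x <= c * 2^-1 ^+ k) -> x <= 0.
Proof.
move=> xk; rewrite leNgt; apply/negP => x0.
have c0 : 0 < c by have := xk 0%N; rewrite expr0; lra.
have [k] := @exists_halving R (x / c) (divr_gt0 x0 c0).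
by rewrite ltr_pdivlMr // mulrC ltNge xk.
Qed.

Section Decoder.
Variables (R : realType) (X : pointedType) (d : X -> X -> R).
Variable A : nat -> set X.
Hypotheses (dm : is_metric d) (dcp : dcomplete d) (bA : small_base d A).

Let dxx x : d x x = 0. Proof. by apply/(proj1 dm). Qed.
Let dC x y : d x y = d y x. Proof. by case: dm => _ [+ _]; apply. Qed.
Let dtri x y z : d x z <= d x y + d y z.
Proof. by case: dm => _ [_ +]; apply. Qed.

Let r k : R := 2^-1 ^+ k.
Let r_gt0 k : 0 < r k. Proof. by rewrite exprn_gt0. Qed.
Let rS k : r k = 2 * r k.+1.
Proof. by rewrite /r exprS; lra. Qed.

Definition small k n : bool :=
  `[< forall y z, A n y -> A n z -> d y z < r k >].

(** For empty [A n] this is the default point of [X]. *)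
Definition center n : X := get (A n).

(* Index of the k-th approximation of the point coded by [b]: a basic set
   containing the point and of diameter less than [2 ^ -k], skipped when it is
   too far from its predecessor, so that every [b] yields a Cauchy sequence. *)
Fixpoint approx_index k (b : nat -> bool) : nat :=
  if k is k'.+1 then
    let i := approx_index k' b in
    first (fun n => b n && (small k n && (d (center i) (center n) < 2 * r k'))) i
  else first (fun n => b n && small 0 n) 0.

Let approx k b := center (approx_index k b).

(** Once the previous index is fixed, the next one is a [first] for a fixed predicate; there are
    countably many previous indices to sum over. *)
Lemma measurable_approx_index k m :
  measurable [set b : bitspace | approx_index k b = m].
Proof.
elim: k m => [|k IHk] m; first exact: measurable_first.
rewrite (_ : [set _ | _] = \bigcup_i ([set b : bitspace | approx_index k b = i] `&`
  [set b : bitspace | first (fun n => b n && (small k.+1 n &&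
    (d (center i) (center n) < 2 * r k))) i = m])).
  apply: bigcup_measurable => i _; apply: measurableI; first exact: IHk.
  exact: (@measurable_first (fun n => small k.+1 n &&
    (d (center i) (center n) < 2 * r k))).
apply/seteqP; split => b /=; first by exists (approx_index k b).
by move=> [i _ [/= -> ]].
Qed.

Lemma approx_step k b : d (approx k b) (approx k.+1 b) <= 2 * r k.
Proof.
rewrite /approx /=.
apply: (@first_ind (fun n => d (center _) (center n) <= _)) => [n|_].
  by case/andP=> _ /andP[_ /ltW].
by rewrite dxx mulr_ge0 // ltW.
Qed.

(** Sum of the geometric series of step bounds [2 * r j]; the exact value of the partial sum is kept
    so that the induction closes. *)
Lemma approx_dist k m b :
  d (approx k b) (approx (k + m) b) <= 4 * r k - 4 * r (k + m).
Proof.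
elim: m => [|m IHm]; first by rewrite addn0 dxx subrr.
rewrite addnS; have := rS (k + m); have := approx_step (k + m) b.
have := dtri (approx k b) (approx (k + m) b) (approx (k + m).+1 b).
lra.
Qed.

Lemma approx_limit b : exists x, forall k, d (approx k b) x <= 4 * r k.
Proof.
have cau : dcauchy d (approx^~ b).
  (* Two terms beyond [N] are each within [4 * r N] of the [N]-th one, hence within [8 * r N] of
     each other. *)
  move=> e e0; have [N Ne] := @exists_halving R (e / 8) ltac:(lra).
  exists N => m n /subnKC <- /subnKC <-.
  have := approx_dist N (m - N) b; have := approx_dist N (n - N) b.
  have := r_gt0 (N + (m - N)); have := r_gt0 (N + (n - N)).
  set y := approx (_ + (m - N)) b; set z := approx (_ + (n - N)) b.
  have := dtri y (approx N b) z; rewrite (dC y (approx N b)).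
  by rewrite -/(r N) in Ne; lra.
have [x xlim] := dcp cau; exists x => k.
rewrite leNgt; apply/negP => kx.
have [N Nx] := xlim (d (approx k b) x - 4 * r k) ltac:(lra).
have := Nx (k + N)%N (leq_addl _ _); have := approx_dist k N b.
have := dtri (approx k b) (approx (k + N) b) x; have := r_gt0 (k + N).
lra.
Qed.

Definition decode (b : bitspace) : Borel d := projT1 (cid (approx_limit b)).

Lemma decodeP k b : d (approx k b) (decode b) <= 4 * r k.
Proof. exact: projT2 (cid (approx_limit b)) k. Qed.

Lemma measurable_decode : measurable_fun setT decode.
Proof.
apply: (@measurability _ _ _ _ setT decode (dopen d) erefl) => _ [U oU <-].
(* The decoded point is within [4 * r k] of the [k]-th center, so it lies in the open ball of radius
   [5 * r k]. Conversely this ball stays within [9 * r k] of the decoded point, whence [e / 9]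
   below. *)
rewrite setTI (_ : _ @^-1` _ = \bigcup_k \bigcup_(i in
    [set i | dball d (center i) (5 * r k) `<=` U])
    [set b : bitspace | approx_index k b = i]).
  apply: bigcup_measurable => k _; apply: bigcup_measurable => i _.
  exact: measurable_approx_index.
apply/seteqP; split=> b /=.
- move=> /oU [e e0 eU].
  have [k ke] := @exists_halving R (e / 9) ltac:(lra).
  exists k => //; exists (approx_index k b) => //= z; rewrite /dball/= => zk.
  apply: eU; rewrite /dball/=; have := decodeP k b.
  rewrite -/(r k) in ke; have := dtri (decode b) (approx k b) z.
  by rewrite (dC (decode b) (approx k b)) /approx; lra.
- move=> [k _ [i + bi]]; apply; rewrite /dball/=.
  by have := decodeP k b; have := r_gt0 k; rewrite /approx bi; lra.
Qed.

(** On the true code of [x] no level is skipped: the current center and that of a small set of level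
    [k.+1] around [x] are at distance less than [r k + r k.+1], below the tolerance [2 * r k]. So
    every approximating set contains [x]. *)
Lemma decode_bits x : decode (fun n => `[< A n x >]) = x.
Proof.
set b : nat -> bool := fun n => _.
have centerP n : A n x -> A n (center n) by move=> Ax; apply: getPex; exists x.
have ball_center k n : A n x -> small k n -> d (center n) x < r k.
  by move=> Ax /asboolP; apply => //; apply: centerP.
have exk k : exists n, A n x /\ small k n.
  by have [n Ax sn] := bA.2 x _ (r_gt0 k); exists n; split => //; apply/asboolP.
have approxP k : A (approx_index k b) x /\ small k (approx_index k b).
  elim: k => [|k [Ak sk]] /=; [apply: (@first_ind (fun n => A n x /\ small 0 n))
                          |apply: (@first_ind (fun n => A n x /\ small k.+1 n))].
  - by move=> n /andP[/asboolP].
  - have [n [An sn]] := exk 0%N; move=> /(_ n); rewrite sn andbT.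
    by move=> /asboolP.
  - by move=> n /andP[/asboolP ? /andP[]].
  - have [n [An sn]] := exk k.+1; move=> /(_ n); rewrite sn /=.
    rewrite /b (asboolT An) => /negP[].
    have := ball_center _ _ An sn; have := ball_center _ _ Ak sk.
    have := dtri (center (approx_index k b)) x (center n).
    by rewrite (dC x (center n)); have := rS k; have := r_gt0 k.+1; lra.
apply/(proj1 dm)/eqP; rewrite eq_le metric_ge0 // andbT.
(* The factor 5 is 4 for the distance to the limit plus 1 for the diameter of the basic set. *)
apply: (@le_halving R _ 5) => k; have [Ak sk] := approxP k.
have := ball_center _ _ Ak sk; have := decodeP k b.
have := dtri (decode b) (approx k b) x.
by rewrite (dC (decode b) (approx k b)) -/(r k) /approx; lra.
Qed.

End Decoder.

(** * Realizing finitely additive laws on the unit interval *)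

Section UnitInterval.
Variable R : realType.
Notation L := (@lebesgue_measure R).

Lemma measurable_unitI : measurable (@unitI R).
Proof. exact: measurable_itv. Qed.

(** A probability on the whole line that is carried by [unitI], so that parameters can stay total
    functions on the line. *)
Definition unit_law : set (measurableTypeR R) -> \bar R :=
  mrestr L measurable_unitI.

HB.instance Definition _ := Measure.on unit_law.

Lemma unit_law_setT : unit_law setT = 1%E.
Proof.
rewrite /unit_law /mrestr setTI /unitI lebesgue_measure_itv /= lte_fin ltr01.
by rewrite oppr0 adde0.
Qed.

HB.instance Definition _ :=
  Measure_isProbability.Build _ _ _ unit_law unit_law_setT.

Lemma unit_lawE A : unit_law A = L (unitI `&` A).
Proof. by rewrite /unit_law /mrestr setIC. Qed.

End UnitInterval.

Fixpoint prefix (b : nat -> bool) (n : nat) : seq bool :=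
  if n is n'.+1 then b n' :: prefix b n' else [::].

Lemma prefix_inj b b' n : prefix b n = prefix b' n ->
  forall i, (i < n)%N -> b i = b' i.
Proof.
elim: n => //= n IHn [bn /IHn bb'] i; rewrite ltnS leq_eqVlt.
by case/orP => [/eqP ->|/bb'].
Qed.

Lemma eq_prefix b b' n : (forall i, (i < n)%N -> b i = b' i) ->
  prefix b n = prefix b' n.
Proof.
elim: n => //= n IHn bb'; rewrite bb' // IHn // => i ni.
by apply: bb'; rewrite ltnW.
Qed.

(* Words are stored with the most recent bit first. *)
Definition cylinder (w : seq bool) : set (nat -> bool) :=
  [set b | prefix b (size w) = w].

Lemma cylinder_determined w : determined (size w) (cylinder w).
Proof.
move=> b b' bb' Cb; rewrite /cylinder /= -[RHS]Cb.
by apply/esym/eq_prefix. Qed.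

Lemma cylinder_cons c w :
  cylinder (c :: w) = [set b | b (size w) = c] `&` cylinder w.
Proof.
apply/seteqP; split => b /=; first by case=> bw Cb; split.
by rewrite /cylinder/= => -[-> ->].
Qed.

Lemma cylinder_split w : cylinder w = cylinder (true :: w) `|` cylinder (false :: w).
Proof.
rewrite !cylinder_cons -setIUl (_ : _ `|` _ = setT) ?setTI //.
by apply/seteqP; split => // b _ /=; case: (b _); [left|right].
Qed.

Lemma cylinder_disj w : cylinder (true :: w) `&` cylinder (false :: w) = set0.
Proof.
rewrite !cylinder_cons; apply/seteqP; split => // b /= [[-> _] []].
by [].
Qed.

Section FinitelyAdditive.
Variables (R : realType) (dT : measure_display) (T : measurableType dT).

Definition finitely_additive_law (nu : set T -> R) : Prop :=
  [/\ forall E, measurable E -> 0 <= nu E,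
      nu setT = 1 &
      forall E F, measurable E -> measurable F -> E `&` F = set0 ->
        nu (E `|` F) = nu E + nu F].

Variable nu : set T -> R.
Hypothesis nuP : finitely_additive_law nu.

Lemma finitely_additive_set0 : nu set0 = 0.
Proof.
have [_ _ /(_ set0 set0 measurable0 measurable0)] := nuP.
by rewrite setI0 setU0 => /(_ erefl); lra.
Qed.

Lemma finitely_additive_le E F : measurable E -> measurable F ->
  E `<=` F -> nu E <= nu F.
Proof.
move=> mE mF EF; have [nu0 _ nuU] := nuP.
rewrite -(setDUK EF) nuU ?setDIK //; last exact: measurableD.
by rewrite lerDl nu0 //; apply: measurableD.
Qed.

End FinitelyAdditive.

Section NestedIntervals.
Variables (R : realType) (p : seq bool -> R).
Notation L := (@lebesgue_measure R).
Hypotheses (p_ge0 : forall w, 0 <= p w) (p_nil : p [::] = 1).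
Hypothesis p_cons : forall w, p w = p (true :: w) + p (false :: w).

(** The word [w] owns the half-open interval of length [p w] that starts here. Its [false] child
    takes the left part and its [true] child the right part. *)
Fixpoint left_end (w : seq bool) : R :=
  if w is c :: w' then left_end w' + (if c then p (false :: w') else 0) else 0.

Fixpoint word (t : R) (k : nat) : seq bool :=
  if k is k'.+1 then
    (left_end (word t k') + p (false :: word t k') <= t) :: word t k'
  else [::].

(** The digits of [t] in this nested partition; they are the binary digits when [p w] is
    [2 ^ - size w]. *)
Definition bit (t : R) (k : nat) : bool :=
  left_end (word t k) + p (false :: word t k) <= t.

Lemma prefix_bit t k : prefix (bit t) k = word t k.
Proof. by elim: k => //= k ->. Qed.

(** Half-open intervals partition their parent exactly, so the equivalence has no exceptional
    endpoints; a word of mass zero owns the empty interval. *)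
Lemma cylinder_bit t w : 0 <= t < 1 ->
  cylinder w (bit t) <-> left_end w <= t < left_end w + p w.
Proof.
move=> t01; elim: w => [|c w IHw]; first by rewrite /= p_nil add0r; split.
rewrite cylinder_cons.
have E : ([set b : nat -> bool | b (size w) = c] `&` cylinder w) (bit t) <->
  ((left_end w + p (false :: w) <= t) = c /\ cylinder w (bit t)).
  split => -[].
    by rewrite /= /bit => + Cw; move: (Cw); rewrite /cylinder/= prefix_bit => ->.
  by move=> + Cw; move: (Cw); rewrite /cylinder/= prefix_bit /bit => ->.
apply: (iff_trans E) => {E}; rewrite IHw /=.
have := p_cons w; have := p_ge0 (true :: w); have := p_ge0 (false :: w).
move=> pf pt pw; case: c => /=.
- split => [[wt /andP[_ tw]]|/andP[wt tw]]; first by apply/andP; split=> //; lra.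
  by split => //; apply/andP; split; lra.
- split => [[/negbT + /andP[wt tw]]|/andP[wt tw]].
    by rewrite -ltNge => tw'; apply/andP; split; lra.
  by split; [apply/negbTE; rewrite -ltNge|apply/andP; split]; lra.
Qed.

Lemma left_end_bounds w : 0 <= left_end w /\ left_end w + p w <= 1.
Proof.
elim: w => [|c w [IH0 IH1]] /=; first by rewrite p_nil; lra.
have := p_cons w; have := p_ge0 (true :: w); have := p_ge0 (false :: w).
by case: c; lra.
Qed.

Lemma unit_law_cylinder w :
  L (unitI `&` [set t | cylinder w (bit t)]) = (p w)%:E.
Proof.
have [w0 w1] := left_end_bounds w; have pw := p_ge0 w.
rewrite (_ : _ `&` _ = `[left_end w, left_end w + p w[%classic).
  rewrite lebesgue_measure_itv /= lte_fin; case: ifPn => [_|].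
    by rewrite -EFinD; congr EFin; lra.
  (* Here the interval is empty and [p w] is 0. *)
  by rewrite -leNgt => ?; congr EFin; lra.
apply/seteqP; split => t /=; rewrite /unitI /= !in_itv /=.
  by move=> [t01 /cylinder_bit]; apply.
move=> tw; have t01 : 0 <= t < 1 by move/andP: tw => [? ?]; apply/andP; split; lra.
by split => //; apply/cylinder_bit.
Qed.

Lemma measurable_word k w :
  measurable ([set t | word t k = w] : set (measurableTypeR R)).
Proof.
elim: k w => [|k IHk] [|c w] /=.
- by rewrite (_ : [set _ | _] = setT) //; apply/seteqP; split.
- by rewrite (_ : [set _ | _] = set0) //; apply/seteqP; split.
- by rewrite (_ : [set _ | _] = set0) //; apply/seteqP; split.
pose B : set (measurableTypeR R) := `[left_end w + p (false :: w), +oo[%classic.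
have mB : measurable B by exact: measurable_itv.
rewrite (_ : [set _ | _] = [set t | word t k = w] `&` if c then B else ~` B).
  by apply: measurableI; [exact: IHk|case: c => //; exact: measurableC].
apply/seteqP; split => t /=.
  case=> tc tw; split => //; rewrite -tc tw.
  by case: ifPn => [|/negP]; rewrite /B /= in_itv /= andbT.
case=> tw; rewrite tw; case: c; rewrite /B /= in_itv /= andbT; first by move=> ->.
by move/negP/negbTE => ->.
Qed.

Lemma measurable_bit i :
  measurable ([set t | bit t i] : set (measurableTypeR R)).
Proof.
pose B w : set (measurableTypeR R) := `[left_end w + p (false :: w), +oo[%classic.
(* The [i]-th bit is decided by a threshold that depends on the current word; words are countable,
   so the union is indexed by their codes. *)
have [dec decK] : exists dec, forall w : seq bool, dec (pickle w) = Some w.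
  by exists unpickle => w; exact: pickleK.
rewrite (_ : [set _ | _] = \bigcup_n (if dec n is Some w then
    [set t | word t i = w] `&` B w else set0 : set (measurableTypeR R))).
  apply: bigcup_measurable => n _; case: (dec n) => [w|];
    last exact: (@measurable0 _ (measurableTypeR R)).
  by apply: measurableI; [exact: measurable_word|exact: measurable_itv].
apply/seteqP; split => t /=.
  move=> ti; exists (pickle (word t i)) => //=; rewrite decK; split => //.
  by rewrite /B /= in_itv /= andbT.
move=> [n _]; case: (dec n) => [w|] // -[/= tw].
by rewrite /B /= in_itv /= andbT /bit tw.
Qed.

Variables (dT : measure_display) (T : measurableType dT) (nu : set T -> R).
Variable bits : T -> nat -> bool.
Hypothesis nuP : finitely_additive_law nu.
Hypothesis mbits : forall i, measurable [set z | bits z i].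
Hypothesis pE : forall w, p w = nu (bits @^-1` cylinder w).

(** Induction on the number [m] of bits still free after the word [w]. With none left, [F] contains
    the cylinder of [w] or misses it; otherwise the cylinder splits in two. Only finitely many
    splittings occur, so finite additivity of [nu] is enough. *)
Lemma clopen_law F : clopen F ->
  L (unitI `&` bit @^-1` F) = (nu (bits @^-1` F))%:E.
Proof.
move=> [n dF]; have [nu0 nu1 nuU] := nuP.
have mbit := determined_preimage (T := measurableTypeR R) measurable_bit.
have mb := determined_preimage mbits.
suff H m w : determined (m + size w) F -> unit_law (bit @^-1` (F `&` cylinder w))
    = (nu (bits @^-1` (F `&` cylinder w)))%:E.
  have := H n [::]; rewrite addn0 => /(_ dF).
  by rewrite -unit_lawE (_ : cylinder [::] = setT) ?setIT //; apply/seteqP.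
elim: m w => [|m IHm] w dFw.
  have [[b [Fb Cb]]|F0] := pselect (F `&` cylinder w !=set0).
    rewrite (_ : F `&` cylinder w = cylinder w).
      by rewrite unit_lawE unit_law_cylinder pE.
    apply/seteqP; split => [b' []//|b' Cb']; split => //.
    by apply: dFw Fb; rewrite add0n; apply: prefix_inj; rewrite Cb Cb'.
  rewrite (_ : F `&` cylinder w = set0).
    by rewrite !preimage_set0 measure0 (finitely_additive_set0 nuP).
  by apply/seteqP; split => // b Fb; apply: F0; exists b.
have dc c : determined (m.+1 + size w) (F `&` cylinder (c :: w)).
  move=> b b' bb' [Fb Cb]; split; first exact: dFw Fb.
  apply: cylinder_determined Cb => i iw; apply: bb'.
  by rewrite (leq_trans iw) //= addSn ltnS leq_addl.
rewrite cylinder_split setIUr !preimage_setU.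
have disj (U : Type) (f : U -> nat -> bool) :
    f @^-1` (F `&` cylinder (true :: w)) `&` f @^-1` (F `&` cylinder (false :: w)) = set0.
  rewrite -preimage_setI setIACA cylinder_disj setI0; exact: preimage_set0.
rewrite nuU //; [|exact: mb (dc _)..].
rewrite measureU //; [|exact: mbit (dc _)..].
rewrite EFinD; congr (_ + _)%E; apply: IHm.
all: by rewrite /= addnS.
Qed.

End NestedIntervals.

Lemma exists_image_law (R : realType) d d' (T : measurableType d)
    (T' : measurableType d') (P : probability T R) (f : T -> T') :
  measurable_fun setT f ->
  exists Q : probability T' R, forall A, Q A = P (f @^-1` A).
Proof.
move=> mf; pose mixin := isMeasurableFun.Build _ _ _ _ f mf.
pose F : {mfun T >-> T'} := HB.pack f mixin.
by exists (distribution P F).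
Qed.

(** This is where countable additivity is gained: the law of [beta] is the image of Lebesgue
    measure, yet it agrees on clopen sets with the law of [bits] under the finitely additive
    [nu]. *)
Lemma exists_bits (R : realType) d (T : measurableType d) (nu : set T -> R)
    (bits : T -> nat -> bool) :
  finitely_additive_law nu -> (forall i, measurable [set z | bits z i]) ->
  exists beta : R -> nat -> bool,
    (forall i, measurable ([set t | beta t i] : set (measurableTypeR R))) /\
    forall F, clopen F ->
      unit_law (beta @^-1` F) = (nu (bits @^-1` F))%:E.
Proof.
move=> nuP mbits; have [nu0 nu1 nuU] := nuP.
pose p w := nu (bits @^-1` cylinder w).
have mC w : measurable (bits @^-1` cylinder w).
  exact: determined_preimage mbits _ _ (@cylinder_determined w).
have p0 w : 0 <= p w by apply: nu0.
have p1 : p [::] = 1.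
  by rewrite /p (_ : cylinder [::] = setT) ?preimage_setT //; apply/seteqP.
have pS w : p w = p (true :: w) + p (false :: w).
  rewrite /p cylinder_split preimage_setU nuU //.
  by rewrite -preimage_setI cylinder_disj preimage_set0.
exists (bit p); split; first exact: measurable_bit.
move=> F cF; rewrite unit_lawE.
exact: (clopen_law p0 p1 pS nuP mbits _ cF).
Qed.

Lemma clopen_reindex (s : nat -> nat) F : clopen F ->
  clopen [set b : nat -> bool | F (b \o s)].
Proof.
move=> [n dF]; exists (\max_(i < n) (s i).+1)%N => b b' bb' /=; apply: dF => i ni.
apply: bb'.
exact: (leq_bigmax (Ordinal ni) (F := fun i : 'I_n => (s i).+1)).
Qed.

(** * Decoding a subsequence of bits into a parameter *)

Section Marginal.
Variables (R : realType) (X : pointedType) (dX : X -> X -> R).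
Variable A : nat -> set X.
Hypotheses (dm : is_metric dX) (dcp : dcomplete dX) (bA : small_base dX A).
Variable mX : probability (Borel dX) R.
Variables (d : measure_display) (T : measurableType d) (nu : set T -> R).
Variables (bits : T -> nat -> bool) (f : T -> Borel dX) (s : nat -> nat).
Hypothesis nuf : forall E : set (Borel dX), measurable E ->
  mX E = (nu (f @^-1` E))%:E.
Hypothesis bitsE : forall z i, bits z (s i) = `[< A i (f z) >].
Variable beta : R -> nat -> bool.
Hypothesis mbeta : forall i,
  measurable ([set t | beta t i] : set (measurableTypeR R)).
Hypothesis betaE : forall F, clopen F ->
  unit_law (beta @^-1` F) = (nu (bits @^-1` F))%:E.

Let phi (t : measurableTypeR R) : Borel dX := decode A dm dcp (beta t \o s).

Let code (x : Borel dX) : bitspace := fun i => `[< A i x >].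
Let sbeta (t : measurableTypeR R) : bitspace := beta t \o s.

Let mA i : measurable (A i : set (Borel dX)).
Proof. by apply: sub_sigma_algebra; apply: bA.1. Qed.

Let mcode : measurable_fun setT code.
Proof.
apply: measurable_bitsP => i; rewrite (_ : [set _ | _] = A i) //.
by apply/seteqP; split => x /asboolP.
Qed.

Let msbeta : measurable_fun setT sbeta.
Proof. by apply: measurable_bitsP => i; apply: mbeta. Qed.

(** The bits selected by [s] are the code of [f], whose law under [nu] is the countably additive
    [mX]. Both sides are therefore probabilities that agree on clopen sets, hence everywhere. *)
Let law_eq (F : set bitspace) : measurable F ->
  unit_law (sbeta @^-1` F) = mX (code @^-1` F).
Proof.
have [Q1 Q1E] := exists_image_law (@unit_law R) msbeta.
have [Q2 Q2E] := exists_image_law mX mcode.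
move=> mF; rewrite -Q1E -Q2E; apply: probability_eq_clopen => // G cG.
rewrite Q1E Q2E; apply: (eq_trans (betaE (clopen_reindex s cG))); rewrite nuf.
  congr (nu _)%:E; apply/seteqP; split => z /=;
  by rewrite (_ : bits z \o s = code (f z)) //; apply/funext => i; rewrite /= bitsE.
rewrite -[X in measurable X]setTI; apply: mcode => //.
exact: sub_sigma_algebra.
Qed.

Let measurable_phi : measurable_fun setT phi.
Proof. exact: (@measurableT_comp _ _ _ _ _ _ (decode A dm dcp) setT sbeta
  (measurable_decode A dm dcp) msbeta). Qed.

Let parameter_phi : parameter mX phi.
Proof.
split; first exact: measurable_funS measurable_phi.
move=> E mE; rewrite -unit_lawE.
have mD := measurable_decode A dm dcp.
rewrite (_ : phi @^-1` E = sbeta @^-1` (decode A dm dcp @^-1` E)) //.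
rewrite law_eq; last by rewrite -[X in measurable X]setTI; apply: mD.
congr (mX _); apply/seteqP; split => x /=;
by rewrite (decode_bits dm dcp bA x).
Qed.

(** Decoding can return a point of [A i] although bit [i] is off, but never on a true code. By
    [law_eq] such bit sequences are negligible, so outside the null set [N] events about the decoded
    point can be bounded by events about bits. *)
Lemma exists_parameter_of_bits :
  exists (phi : measurableTypeR R -> Borel dX) (N : set (measurableTypeR R)),
    [/\ measurable_fun setT phi, parameter mX phi, measurable N,
        unit_law N = 0%E & forall t i, ~ N t -> A i (phi t) -> beta t (s i)].
Proof.
have mD := measurable_decode A dm dcp.
pose N : set bitspace := \bigcup_i
  (decode A dm dcp @^-1` A i `\` [set b : bitspace | b i]).
have mN : measurable N.
  apply: bigcup_measurable => i _; apply: measurableD; last exact: measurable_coord.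
  by rewrite -[X in measurable X]setTI; apply: mD.
exists phi, (sbeta @^-1` N); split => //.
- by rewrite -[X in measurable X]setTI; apply: msbeta.
- rewrite law_eq // (_ : _ @^-1` _ = set0) ?measure0 //.
  apply/seteqP; split => // x [i _] /=; rewrite (decode_bits dm dcp bA x) => -[Ax].
  by case; apply/asboolP.
- move=> t i Nt At; apply/negPn/negP => bt; apply: Nt.
  by exists i => //; split => //=; apply/negP.
Qed.

End Marginal.

(** * Parameters realizing a finitely additive coupling *)

Section Realization.
Variables (R : realType) (X Y : pointedType).
Variables (dX : X -> X -> R) (dY : Y -> Y -> R).
Hypotheses (hX : complete_separable_metric dX).
Hypotheses (hY : complete_separable_metric dY).
Variables (mX : probability (Borel dX) R) (mY : probability (Borel dY) R).
Variables (A : nat -> set X) (B : nat -> set Y).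
Hypotheses (bA : small_base dX A) (bB : small_base dY B).

(** The rectangles selected by [P] are forbidden. A bound on their finite unions under [nu] becomes
    a bound on the whole countable union, because the new law is countably additive. *)
Lemma exists_parameters d (T : measurableType d) (nu : set T -> R)
    (f : T -> Borel dX) (g : T -> Borel dY) (P : nat -> nat -> Prop) (e : R) :
  finitely_additive_law nu -> measurable_fun setT f -> measurable_fun setT g ->
  (forall E : set (Borel dX), measurable E -> mX E = (nu (f @^-1` E))%:E) ->
  (forall E : set (Borel dY), measurable E -> mY E = (nu (g @^-1` E))%:E) ->
  (forall n, nu [set z | exists i j,
     [/\ [/\ (i < n)%N, (j < n)%N & P i j], A i (f z) & B j (g z)]] <= e) ->
  exists (phi : measurableTypeR R -> Borel dX) (psi : measurableTypeR R -> Borel dY),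
    [/\ measurable_fun setT phi, measurable_fun setT psi,
        parameter mX phi, parameter mY psi &
        (lebesgue_measure (unitI `&`
          [set t | exists i j, [/\ P i j, A i (phi t) & B j (psi t)]]) <= e%:E)%E].
Proof.
move=> nuP mf mg nuf nug nue.
have [dmX dcX dsX] := hX; have [dmY dcY dsY] := hY.
have mA i : measurable (A i : set (Borel dX)).
  by apply: sub_sigma_algebra; apply: bA.1.
have mB i : measurable (B i : set (Borel dY)).
  by apply: sub_sigma_algebra; apply: bB.1.
(* Even positions code [f z] and odd ones [g z], so that one bit sequence carries the joint law. *)
pose bits z k := if odd k then `[< B k./2 (g z) >] else `[< A k./2 (f z) >].
have bitsA z i : bits z i.*2 = `[< A i (f z) >].
  by rewrite /bits odd_double doubleK.
have bitsB z i : bits z i.*2.+1 = `[< B i (g z) >].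
  by rewrite /bits /= odd_double /= uphalf_double.
have mbits k : measurable [set z | bits z k].
  rewrite /bits; case: (odd k).
    rewrite (_ : [set _ | _] = g @^-1` B k./2).
      by rewrite -[X in measurable X]setTI; apply: mg.
    by apply/seteqP; split => z /asboolP.
  rewrite (_ : [set _ | _] = f @^-1` A k./2).
    by rewrite -[X in measurable X]setTI; apply: mf.
  by apply/seteqP; split => z /asboolP.
have [beta [mbeta betaE]] := exists_bits nuP mbits.
have [phi [NX [mphi pphi mNX NX0 cX]]] :=
  exists_parameter_of_bits dmX dcX bA nuf bitsA mbeta betaE.
have [psi [NY [mpsi ppsi mNY NY0 cY]]] :=
  exists_parameter_of_bits dmY dcY bB nug bitsB mbeta betaE.
exists phi, psi; split => //.
(* Finite stages of the forbidden event in terms of bits; stage [n] reads only the first [2 n]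
   bits. *)
pose F n : set (nat -> bool) := [set b | exists i j,
  [/\ (i < n)%N, (j < n)%N, P i j, b i.*2 & b j.*2.+1]].
have cF n : clopen (F n).
  exists n.*2 => b b' bb' [i [j [ni nj Pij bi bj]]]; exists i, j; split => //.
    by rewrite -bb' // ltn_double.
  by rewrite -bb' // -doubleS leq_double.
pose G n : set (measurableTypeR R) := beta @^-1` F n.
have mG n : measurable (G n).
  by have [k dF] := cF n; apply: determined_preimage mbeta _ _ dF.
have Ge n : (unit_law (G n) <= e%:E)%E.
  rewrite betaE // lee_fin; apply: le_trans (nue n).
  rewrite le_eqVlt; apply/orP; left; apply/eqP; congr nu.
  apply/seteqP; split => z [i [j []]].
  - move=> ni nj Pij; rewrite bitsA bitsB => /asboolP Ai /asboolP Bj.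
    by exists i, j.
  - move=> [ni nj Pij] /asboolP Ai /asboolP Bj.
    by exists i, j; rewrite bitsA bitsB.
have mGU : measurable (\bigcup_n G n) by exact: bigcup_measurable.
have GUe : (unit_law (\bigcup_n G n) <= e%:E)%E.
  have Gnd : {homo G : n m / (n <= m)%N >-> (n <= m)%O}.
    move=> n m nm; apply/subsetPset => t [i [j [ni nj Pij bi bj]]].
    by exists i, j; split => //; [exact: leq_trans ni nm|exact: leq_trans nj nm].
  have cvgG := @nondecreasing_cvg_mu _ _ R (@unit_law R) G mG mGU Gnd.
  by apply: (cvge_to_le cvgG); near=> n; apply: Ge.
have mbad : measurable ([set t | exists i j,
    [/\ P i j, A i (phi t) & B j (psi t)]] : set (measurableTypeR R)).
  rewrite (_ : [set _ | _] = \bigcup_i \bigcup_(j in [set j | P i j])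
    (phi @^-1` A i `&` psi @^-1` B j)).
    apply: bigcup_measurable => i _; apply: bigcup_measurable => j _.
    apply: measurableI; rewrite -[X in measurable X]setTI.
      exact: mphi.
    exact: mpsi.
  apply/seteqP; split => t.
    by move=> [i [j [Pij Ai Bj]]]; exists i => //; exists j.
  by move=> [i _ [j Pij [Ai Bj]]]; exists i, j.
(* Off the two null sets, a decoded pair in a forbidden rectangle has the corresponding bits on, so
   it is caught at stage [(maxn i j).+1]. *)
rewrite -unit_lawE; apply: (@le_trans _ _ (unit_law ((\bigcup_n G n) `|` (NX `|` NY)))).
  apply: le_measure; rewrite ?inE //; first by do 2 apply: measurableU => //.
  move=> t [i [j [Pij Ai Bj]]]; have [Nt|Nt] := pselect ((NX `|` NY) t); first by right.
  left; exists (maxn i j).+1 => //; exists i, j; split => //.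
  - by rewrite ltnS leq_maxl.
  - by rewrite ltnS leq_maxr.
  - by apply: cX Ai => Xt; apply: Nt; left.
  - by apply: cY Bj => Yt; apply: Nt; right.
rewrite measureU0 //; first exact: measurableU.
by rewrite -[LHS]/(unit_law _) measureU0.
Unshelve. all: end_near. Qed.

End Realization.

(** * Borel sets of a product *)

Lemma probability_finitely_additive d (T : measurableType d) (R : realType)
    (P : probability T R) : finitely_additive_law (fun E => fine (P E)).
Proof.
split=> [E mE||E F mE mF EF]; first exact: fine_ge0.
  by rewrite probability_setT.
by rewrite measureU // fineD // fin_num_measure.
Qed.

Section Product.
Variables (R : realType) (X Y : pointedType).
Variables (dX : X -> X -> R) (dY : Y -> Y -> R).

Lemma measurable_borel_fst :
  measurable_fun setT (fst : Borel (dprod dX dY) -> Borel dX).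
Proof.
apply: (@measurability _ _ (Borel (dprod dX dY)) (Borel dX) setT fst
  (dopen dX) erefl) => _ [U oU <-].
rewrite setTI; apply: sub_sigma_algebra => -[x y] /oU [e e0 eU].
by exists e => // -[x' y']; rewrite /dball /dprod /= gt_max => /andP[xx' _]; apply: eU.
Qed.

Lemma measurable_borel_snd :
  measurable_fun setT (snd : Borel (dprod dX dY) -> Borel dY).
Proof.
apply: (@measurability _ _ (Borel (dprod dX dY)) (Borel dY) setT snd
  (dopen dY) erefl) => _ [U oU <-].
rewrite setTI; apply: sub_sigma_algebra => -[x y] /oU [e e0 eU].
by exists e => // -[x' y']; rewrite /dball /dprod /= gt_max => /andP[_ yy']; apply: eU.
Qed.

Variables (A : nat -> set X) (B : nat -> set Y).
Hypotheses (bA : small_base dX A) (bB : small_base dY B).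

Lemma dprod_open_rect (U : set (X * Y)) : dopen (dprod dX dY) U ->
  forall p, U p -> exists i j,
    [/\ A i p.1, B j p.2 & A i `*` B j `<=` U].
Proof.
move=> oU p /oU[e e0 eU].
have [i Ai Ae] := bA.2 p.1 e e0; have [j Bj Be] := bB.2 p.2 e e0.
exists i, j; split => // q [Aq Bq]; apply: eU.
by rewrite /dball /dprod /= gt_max Ae //= Be.
Qed.

Lemma dopen_bigcup_rect (Q : nat -> nat -> Prop) :
  dopen (dprod dX dY)
    [set z | exists i j, [/\ Q i j, A i z.1 & B j z.2]].
Proof.
move=> z [i [j [Qij Ai Bj]]].
have [r1 r10 Ae] := bA.1 i _ Ai; have [r2 r20 Be] := bB.1 j _ Bj.
exists (Num.min r1 r2); first by rewrite lt_min r10.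
move=> z'; rewrite /dball /dprod /= gt_max !lt_min.
move=> /andP[/andP[z1 _] /andP[_ z2]].
by exists i, j; split => //; [apply: Ae|apply: Be].
Qed.

(** The countable bases make every open set of the product a countable union of open rectangles. *)
Lemma measurable_borel_pair d (T : measurableType d) (D : set T)
    (phi : T -> Borel dX) (psi : T -> Borel dY) :
  measurable_fun D phi -> measurable_fun D psi ->
  measurable_fun D ((fun t => (phi t, psi t)) : T -> Borel (dprod dX dY)).
Proof.
move=> mphi mpsi mD; move: (mD).
apply: (@measurability _ _ T (Borel (dprod dX dY)) D _
  (dopen (dprod dX dY)) erefl) => _ [U oU <-].
rewrite (_ : _ `&` _ = \bigcup_i \bigcup_(j in [set j | A i `*` B j `<=` U])
  ((D `&` phi @^-1` A i) `&` (D `&` psi @^-1` B j))).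
  apply: bigcup_measurable => i _; apply: bigcup_measurable => j _.
  apply: measurableI; [apply: mphi => //|apply: mpsi => //].
  - by apply: sub_sigma_algebra; apply: bA.1.
  - by apply: sub_sigma_algebra; apply: bB.1.
apply/seteqP; split => t.
  move=> [Dt Ut]; have [i [j [Ai Bj ABU]]] := dprod_open_rect oU Ut.
  by exists i => //; exists j.
by move=> [i _ [j ABU [[Dt Ai] [_ Bj]]]]; split => //; apply: ABU.
Qed.

End Product.

(** * Ultralimits of finitely additive laws *)

Section Ultralimit.
Variables (R : realType) (U : set_system nat).
Hypothesis ultraU : UltraFilter U.

Let properU : ProperFilter U. Proof. exact: ultra_proper. Qed.

Lemma ultrafilter_fmap (T : Type) (f : nat -> T) : UltraFilter (f @ U).
Proof.
split; first exact: fmap_proper_filter.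
move=> G properG UG; apply/seteqP; split => // C GC.
have [//|UC] := in_ultra_setVsetC (f @^-1` C) ultraU.
have /UG GnC : (f @ U) (~` C) by [].
have : G (C `&` ~` C) by exact: filterI.
rewrite setICr => G0.
by case: (filter_not_empty _ G0).
Qed.

Lemma ultrafilter_cvg (u : nat -> R) :
  (forall n, 0 <= u n <= 1) -> cvg (u @ U).
Proof.
move=> u01; have := @segment_compact R 0 1.
rewrite compact_ultra => /(_ _ (ultrafilter_fmap u)) [].
  suff : U (u @^-1` `[0, 1]) by [].
  by apply: filterE => n; rewrite /= in_itv /= u01.
by move=> l [_ ul]; apply/cvg_ex; exists l.
Qed.

Variables (d : measure_display) (T : measurableType d) (q : nat -> set T -> R).
Hypothesis qP : forall n, finitely_additive_law (q n).

Lemma finitely_additive_cvg E : measurable E -> cvg (q n E @[n --> U]).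
Proof.
move=> mE; apply: ultrafilter_cvg => n; have [q0 q1 _] := qP n.
rewrite q0 //= -[leRHS]q1; apply: (finitely_additive_le (qP n)) => //.
Qed.

(** An ultrafilter gives limits for all measurable sets at once, without extracting subsequences.
    Finite additivity survives because limits respect sums. *)
Lemma ultralimit_law : finitely_additive_law (fun E => lim (q n E @[n --> U])).
Proof.
split=> [E mE||E F mE mF EF].
- apply: limr_ge; first exact: finitely_additive_cvg.
  by apply: filterE => n; have [q0 _ _] := qP n; apply: q0.
- rewrite (_ : (fun n => q n setT) = fun=> 1) ?lim_cst //.
  by apply/funext => n; have [_ q1 _] := qP n.
- rewrite -limD; [|exact: finitely_additive_cvg..].
  congr (lim (_ @ U)); apply/funext => n /=.
  by have [_ _ qU] := qP n; rewrite qU.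
Qed.

End Ultralimit.

(** * The box distance *)

Lemma unit_law_unitI (R : realType) (E : set (measurableTypeR R)) :
  unit_law (unitI `&` E) = lebesgue_measure (unitI `&` E).
Proof. by rewrite unit_lawE setIA setIid. Qed.

Lemma unitI_image_law (R : realType) d (T : measurableType d)
    (f : measurableTypeR R -> T) : measurable_fun unitI f ->
  finitely_additive_law (fun E => fine (unit_law (unitI `&` f @^-1` E))).
Proof.
move=> mf; have mI := @measurable_unitI R.
split=> [E mE||E F mE mF EF]; first exact: fine_ge0.
  by rewrite preimage_setT unit_lawE setIA setIid -unit_lawE unit_law_setT.
rewrite preimage_setU setIUr measureU; [|exact: mf..|].
  by rewrite fineD //; apply: fin_num_measure; apply: mf.
by rewrite setIACA setIid -preimage_setI EF preimage_set0 setI0.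
Qed.

Section Box.
Variables (R : realType) (X Y : pointedType).
Variables (dX : X -> X -> R) (dY : Y -> Y -> R).
Hypotheses (hX : complete_separable_metric dX).
Hypotheses (hY : complete_separable_metric dY).
Variables (mX : probability (Borel dX) R) (mY : probability (Borel dY) R).

Lemma box_le (phi : measurableTypeR R -> Borel dX)
    (psi : measurableTypeR R -> Borel dY) (I0 : set (measurableTypeR R)) (e : R) :
  parameter mX phi -> parameter mY psi -> 0 <= e ->
  measurable I0 -> I0 `<=` unitI ->
  ((1 - e)%:E <= lebesgue_measure I0)%E ->
  (forall s t, I0 s -> I0 t ->
     `|dX (phi s) (phi t) - dY (psi s) (psi t)| <= e) ->
  (box mX mY <= e%:E)%E.
Proof.
move=> pphi ppsi e0 mI0 I0I I0e dist.
apply: (@le_trans _ _ (box_pm (fun s t => dX (phi s) (phi t))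
                              (fun s t => dY (psi s) (psi t)))).
  by apply: ereal_inf_lbound; exists phi => //; exists psi.
by apply: ereal_inf_lbound; exists e => //; split => //; exists I0.
Qed.

Lemma box_ge0 : (0 <= box mX mY)%E.
Proof.
apply: le_ereal_inf_tmp => _ [phi _ [psi _ <-]].
by apply: le_ereal_inf_tmp => _ [e [e0 _] <-]; rewrite lee_fin.
Qed.

Lemma box_lt (e : R) : (box mX mY < e%:E)%E ->
  exists (phi : measurableTypeR R -> Borel dX)
    (psi : measurableTypeR R -> Borel dY) (I0 : set (measurableTypeR R)),
    [/\ parameter mX phi, parameter mY psi, 
     [/\ measurable I0, I0 `<=` unitI & ((1 - e)%:E <= lebesgue_measure I0)%E] &
     (forall s t, I0 s -> I0 t ->
     `|dX (phi s) (phi t) - dY (psi s) (psi t)| <= e)].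
Proof.
move=> /ereal_inf_lt[_ [phi pphi [psi ppsi <-]]].
move=> /ereal_inf_lt[_ [c [c0 [I0 [mI0 I0I I0c dist]]] <-]]; rewrite lte_fin => ce.
exists phi, psi, I0; split => //.
  split => //; apply: le_trans I0c; rewrite lee_fin; lra.
by move=> s t Is It; apply: le_trans (dist _ _ Is It) (ltW ce).
Qed.

End Box.

(** The space is coupled with itself by two identity maps, with no forbidden rectangle. *)
Lemma exists_parameter (R : realType) (X : pointedType) (dX : X -> X -> R)
    (mX : probability (Borel dX) R) :
  complete_separable_metric dX -> exists phi, parameter mX phi.
Proof.
move=> hX; have [dm _ ds] := hX; have [A bA] := exists_small_base dm ds.
have mXE (E : set (Borel dX)) : measurable E -> mX E = (fine (mX E))%:E.
  by move=> mE; rewrite fineK // fin_num_measure.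
have [phi [_ [_ _ pphi _ _]]] := exists_parameters (P := fun _ _ => False)
  (e := 0) hX hX bA bA (probability_finitely_additive mX)
  (measurable_id (D := setT)) (measurable_id (D := setT)) mXE mXE
  ltac:(by move=> n; rewrite (_ : [set _ | _] = set0) ?measure0 //;
    apply/seteqP; split => // z [i [j [[_ _ []]]]]).
by exists phi.
Qed.

(** For [e = 1] the empty [I0] is admissible; existence of parameters keeps the infimum from being
    [+oo]. *)
Lemma box_le1 (R : realType) (X Y : pointedType)
    (dX : X -> X -> R) (dY : Y -> Y -> R)
    (mX : probability (Borel dX) R) (mY : probability (Borel dY) R) :
  complete_separable_metric dX -> complete_separable_metric dY ->
  (box mX mY <= 1)%E.
Proof.
move=> /(exists_parameter mX)[phi pphi] /(exists_parameter mY)[psi ppsi].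
apply: (box_le pphi ppsi (I0 := set0)) => //.
by rewrite subrr measure0.
Qed.

Lemma dis_ge (R : realType) (X Y : Type) (dX : X -> X -> R) (dY : Y -> Y -> R)
    (S : set (X * Y)) p q : S p -> S q ->
  ((`|dX p.1 q.1 - dY p.2 q.2|)%:E <= dis dX dY S)%E.
Proof.
move=> Sp Sq; rewrite /dis; case: asboolP => [S0|_]; first by rewrite leey.
by apply: ereal_sup_ubound; exists p => //; exists q.
Qed.

Lemma dis_le (R : realType) (X Y : Type) (dX : X -> X -> R) (dY : Y -> Y -> R)
    (S : set (X * Y)) (e : R) : S !=set0 ->
  (forall p q, S p -> S q -> `|dX p.1 q.1 - dY p.2 q.2| <= e) ->
  (dis dX dY S <= e%:E)%E.
Proof.
move=> /set0P S0 dist; rewrite /dis; case: asboolP => [/eqP|_].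
  by rewrite (negbTE S0).
by apply: ge_ereal_sup => _ [p Sp [q Sq <-]]; rewrite lee_fin dist.
Qed.

(** * Upper bound of the box distance by any transport plan *)

Section Main.
Variables (R : realType) (X Y : pointedType).
Variables (dX : X -> X -> R) (dY : Y -> Y -> R).
Hypotheses (hX : complete_separable_metric dX).
Hypotheses (hY : complete_separable_metric dY).
Variables (mX : probability (Borel dX) R) (mY : probability (Borel dY) R).

(** The forbidden rectangles are those inside the open complement of [S], which they cover. The
    resulting pair of parameters avoids [S] with probability at most that under [pi], and the
    preimage of [S] serves as [I0]. *)
Lemma box_le_plan (pi : probability (Borel (dprod dX dY)) R) (S : set (X * Y)) :
  transport_plan mX mY pi -> dclosed (dprod dX dY) S ->
  (box mX mY <= maxe (1 - pi S) (dis dX dY S))%E.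
Proof.
move=> [piX piY] cS; have [dmX _ dsX] := hX; have [dmY _ dsY] := hY.
have [A bA] := exists_small_base dmX dsX.
have [B bB] := exists_small_base dmY dsY.
have mSc : measurable (~` S : set (Borel (dprod dX dY))).
  exact: sub_sigma_algebra.
have mS : measurable (S : set (Borel (dprod dX dY))).
  by rewrite -[S]setCK; apply: measurableC.
pose c := fine (pi (~` S : set (Borel (dprod dX dY)))).
have cE : pi (~` S) = c%:E by rewrite fineK // fin_num_measure.
have -> : (1 - pi S)%E = c%:E by rewrite -probability_setC.
have c0 : 0 <= c by apply: fine_ge0.
(* Distortion [+oo] makes the bound trivial, and [-oo] cannot occur: the distortion of the empty set
   is [+oo] by convention and any other is at least 0. *)
case disE : (dis dX dY S) => [r| |]; last 2 first.
- by rewrite (max_idPr _) ?leey.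
- have [S0|/set0P[p Sp]] := eqVneq S set0; last first.
    by have := dis_ge dX dY Sp Sp; rewrite disE.
  by move: disE; rewrite /dis asboolT.
pose P i j := A i `*` B j `<=` ~` S.
pose T : measurableType _ := Borel (dprod dX dY).
have nuX (E : set (Borel dX)) : measurable E ->
    mX E = (fine (pi ((fst : T -> _) @^-1` E)))%:E.
  move=> mE; rewrite fineK; last first.
    apply: fin_num_measure; rewrite -[X in measurable X]setTI.
    exact: measurable_borel_fst.
  by rewrite -piX //; congr (pi _); apply/seteqP; split => z //= [].
have nuY (E : set (Borel dY)) : measurable E ->
    mY E = (fine (pi ((snd : T -> _) @^-1` E)))%:E.
  move=> mE; rewrite fineK; last first.
    apply: fin_num_measure; rewrite -[X in measurable X]setTI.
    exact: measurable_borel_snd.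
  by rewrite -piY //; congr (pi _); apply/seteqP; split => z //= [].
have [|phi [psi [mphi mpsi pphi ppsi]]] := exists_parameters (P := P) (e := c) hX hY bA bB
  (probability_finitely_additive pi) (@measurable_borel_fst _ _ _ dX dY)
  (@measurable_borel_snd _ _ _ dX dY) nuX nuY.
  move=> n; apply: (finitely_additive_le (probability_finitely_additive pi)) => //.
    apply: sub_sigma_algebra.
    exact: (dopen_bigcup_rect bA bB).
  by move=> z [i [j [[_ _ Pij] Ai Bj]]]; apply: Pij.
have -> : [set t | exists i j, [/\ P i j, A i (phi t) & B j (psi t)]] =
    (fun t => (phi t, psi t)) @^-1` (~` S).
  apply/seteqP; split => t /=.
    by move=> [i [j [Pij Ai Bj]]] St; apply: (Pij (phi t, psi t)).
  by move=> /(dprod_open_rect bA bB cS)[i [j [Ai Bj Pij]]]; exists i, j.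
rewrite -unit_lawE => le_c.
have mpair := measurable_borel_pair bA bB mphi mpsi.
have mbad : measurable ((fun t => (phi t, psi t)) @^-1` (~` S) : set (measurableTypeR R)).
  by rewrite -[X in measurable X]setTI; apply: mpair.
rewrite -EFin_max.
apply: (box_le pphi ppsi (I0 := unitI `&` (fun t => (phi t, psi t)) @^-1` S)).
- by rewrite le_max c0.
- apply: measurableI; first exact: measurable_unitI.
  by rewrite -[X in measurable X]setTI; apply: mpair.
- by move=> t [].
- rewrite -unit_lawE -[S]setCK preimage_setC probability_setC //.
  rewrite EFinB leeB // (le_trans le_c) // lee_fin le_max lexx //.
- move=> s t [_ Ss] [_ St]; have := dis_ge dX dY Ss St.
  by rewrite disE lee_fin le_max => ->; rewrite orbT.
Qed.

End Main.

(** * Construction of an optimal pair *)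

Section Attained.
Variables (R : realType) (X Y : pointedType).
Variables (dX : X -> X -> R) (dY : Y -> Y -> R).
Hypotheses (hX : complete_separable_metric dX).
Hypotheses (hY : complete_separable_metric dY).
Variables (mX : probability (Borel dX) R) (mY : probability (Borel dY) R).

Lemma dclosed_point (p : X * Y) : dclosed (dprod dX dY) [set p].
Proof.
have [dmX _ _] := hX; have [dmY _ _] := hY; move=> q /= qp.
exists (Num.max (dX q.1 p.1) (dY q.2 p.2)).
  rewrite lt_max !lt_neqAle !metric_ge0 // !andbT -negb_and.
  apply/negP => /andP[/eqP/esym/(proj1 dmX) E1 /eqP/esym/(proj1 dmY) E2].
  by apply: qp; rewrite [q]surjective_pairing [p]surjective_pairing E1 E2.
by move=> z /[swap] ->; rewrite /dball/= ltxx.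
Qed.

Lemma exists_parameters_approx (e : R) : box mX mY = e%:E ->
  exists (phi : nat -> measurableTypeR R -> Borel dX)
    (psi : nat -> measurableTypeR R -> Borel dY)
    (I0 : nat -> set (measurableTypeR R)),
  forall n, [/\ parameter mX (phi n), parameter mY (psi n),
   [/\ measurable (I0 n), I0 n `<=` unitI &
       ((1 - (e + n.+1%:R^-1))%:E <= lebesgue_measure (I0 n))%E] &
   (forall s t, I0 n s -> I0 n t ->
     `|dX (phi n s) (phi n t) - dY (psi n s) (psi n t)| <= e + n.+1%:R^-1)].
Proof.
move=> boxE.
have ex n : exists u : (measurableTypeR R -> Borel dX) *
    (measurableTypeR R -> Borel dY) * set (measurableTypeR R),
  [/\ parameter mX u.1.1, parameter mY u.1.2,
   [/\ measurable u.2, u.2 `<=` unitI &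
       ((1 - (e + n.+1%:R^-1))%:E <= lebesgue_measure u.2)%E] &
   (forall s t, u.2 s -> u.2 t ->
     `|dX (u.1.1 s) (u.1.1 t) - dY (u.1.2 s) (u.1.2 t)| <= e + n.+1%:R^-1)].
  have [|phi [psi [I0 H]]] := @box_lt R X Y dX dY mX mY (e + n.+1%:R^-1).
    by rewrite boxE lte_fin ltrDl invr_gt0.
  by exists (phi, psi, I0).
have [u uP] := choice ex.
by exists (fun n => (u n).1.1), (fun n => (u n).1.2), (fun n => (u n).2).
Qed.

Lemma box_attained : exists (pi : probability (Borel (dprod dX dY)) R)
    (S : set (X * Y)),
  [/\ transport_plan mX mY pi, dclosed (dprod dX dY) S &
      (maxe (1 - pi S) (dis dX dY S) <= box mX mY)%E].
Proof.
have [dmX _ dsX] := hX; have [dmY _ dsY] := hY.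
have [A bA] := exists_small_base dmX dsX.
have [B bB] := exists_small_base dmY dsY.
have box1 := box_le1 mX mY hX hY; have box0 := box_ge0 mX mY.
have [e boxE] : exists e : R, box mX mY = e%:E.
  by exists (fine (box mX mY)); rewrite fineK // ge0_fin_numE //;
    rewrite (le_lt_trans box1) // ltey.
have e1 : e <= 1 by rewrite -lee_fin -boxE.
have e0 : 0 <= e by rewrite -lee_fin -boxE.
have [phi [psi [I0 par]]] := exists_parameters_approx boxE.
(* [U] refines the filter of cofinite sets, so the errors [1 / (n + 1)] tend to 0 along it. *)
have [U [ultraU ooU]] := ultraFilterLemma eventually_filter.
have properU : ProperFilter U by exact: ultra_proper.
pose T : measurableType _ := Borel (dprod dX dY).
pose Phi n : measurableTypeR R -> T := fun t => (phi n t, psi n t).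
have mPhi n : measurable_fun unitI (Phi n).
  have [[mphi _] [mpsi _] _ _] := par n.
  refine (measurable_borel_pair bA bB mphi mpsi).
pose q n (E : set T) := fine (unit_law (unitI `&` Phi n @^-1` E)).
have qP n : finitely_additive_law (q n) := unitI_image_law (mPhi n).
have nuP := ultralimit_law ultraU qP.
(* Every [q n] has the exact marginals, so these limits are taken along constant sequences. *)
have nuX (E : set (Borel dX)) : measurable E ->
    mX E = (lim (q n ((fst : T -> _) @^-1` E) @[n --> U]))%:E.
  move=> mE; rewrite (_ : (fun n => _) = fun=> fine (mX E)).
    by rewrite lim_cst // fineK // fin_num_measure.
  apply/funext => n; have [[_ <- //] _ _ _] := par n.
  by rewrite /q unit_law_unitI.
have nuY (E : set (Borel dY)) : measurable E ->
    mY E = (lim (q n ((snd : T -> _) @^-1` E) @[n --> U]))%:E.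
  move=> mE; rewrite (_ : (fun n => _) = fun=> fine (mY E)).
    by rewrite lim_cst // fineK // fin_num_measure.
  apply/funext => n; have [_ [_ <- //] _ _] := par n.
  by rewrite /q unit_law_unitI.
(* The indices [n] for which the image of [I0 n] misses the rectangle; a rectangle is forbidden when
   this happens for [U]-almost all [n]. *)
pose miss i j := [set n | forall t, I0 n t -> A i (phi n t) -> ~ B j (psi n t)].
pose P i j := U (miss i j).
have Ueps (r : R) : 0 < r -> U [set n | n.+1%:R^-1 < r].
  by move=> r0; apply: ooU; have := near_infty_natSinv_lt (PosNum r0).
have mrect n : measurable ([set z | exists i j,
    [/\ [/\ (i < n)%N, (j < n)%N & P i j], A i z.1 & B j z.2]] : set T).
  apply: sub_sigma_algebra.
  exact: (dopen_bigcup_rect bA bB).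
have nuP_le n : lim (q m [set z | exists i j,
    [/\ [/\ (i < n)%N, (j < n)%N & P i j], A i z.1 & B j z.2]] @[m --> U]) <= e.
  apply/ler_addgt0Pr => r r0.
  apply: limr_le; first exact: (finitely_additive_cvg ultraU qP (mrect n)).
  (* A filter is stable under finite intersections only, which is why the rectangles are truncated
     at [n]. *)
  have Uall : U [set m | forall i j, (i < n)%N -> (j < n)%N -> P i j -> miss i j m].
    have Uij i j : U [set m | P i j -> miss i j m].
      have [Pij|nPij] := pselect (P i j); last by apply: filterE => m /nPij.
      by apply: filterS Pij => m mm _.
    have := @filter_forall _ 'I_n _ U properU
      (fun i => @filter_forall _ 'I_n _ U properU (Uij i)).
    by apply: filterS => m mm i j ni nj; apply: (mm (Ordinal ni) (Ordinal nj)).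
  apply: filterS (filterI Uall (Ueps _ r0)) => m [mm mr] /=.
  have [_ _ [mI0 I0I I0e] _] := par m.
  have mPm := mPhi m (@measurable_unitI R) _ (mrect n).
  rewrite -lee_fin /q fineK; last exact: fin_num_measure.
  (* Parameter values whose image lies in a missed rectangle are outside [I0 m], whose complement
     has mass at most [e + 1 / (m + 1)]. *)
  apply: (@le_trans _ _ (unit_law (~` I0 m))).
    apply: le_measure; rewrite ?inE; [exact: mPm|exact: measurableC|].
    move=> t [_ [i [j [[ni nj Pij] Ai Bj]]]] It.
    exact: (mm _ _ ni nj Pij t It Ai Bj).
  have ue : unit_law (I0 m) = lebesgue_measure (I0 m).
    by rewrite unit_lawE (setIidr I0I).
  rewrite probability_setC // leeBlDr; last exact: fin_num_measure.
  rewrite -[X in (_ <= _ + X)%E]/(unit_law (I0 m)) ue.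
  apply: (le_trans _ (leeD2l _ I0e)).
  by rewrite -EFinD lee_fin; move: mr => /=; move: (m.+1%:R^-1) => x xr; lra.
have [phi0 [psi0 [mphi0 mpsi0 pphi0 ppsi0 le_e]]] := exists_parameters hX hY bA bB nuP
  (@measurable_borel_fst _ _ _ dX dY) (@measurable_borel_snd _ _ _ dX dY) nuX nuY nuP_le.
have mpair := measurable_borel_pair bA bB mphi0 mpsi0.
have [pi piE] : exists pi : probability T R, forall E,
    pi E = lebesgue_measure (unitI `&` (fun t => (phi0 t, psi0 t)) @^-1` E).
  have [pi piE] := exists_image_law (@unit_law R) mpair.
  by exists pi => E; rewrite piE; exact: unit_lawE.
have piplan : transport_plan mX mY pi.
  split=> E mE; rewrite piE.
    by have [_ <-//] := pphi0; congr lebesgue_measure;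
      apply/seteqP; split => t /= [It]; [case|].
  by have [_ <-//] := ppsi0; congr lebesgue_measure;
    apply/seteqP; split => t /= [It]; [case|].
(* The complement of all forbidden rectangles, so the bound [le_e] is precisely a bound on the mass
   of its complement. *)
pose S : set (X * Y) := [set z | forall i j, P i j -> A i z.1 -> ~ B j z.2].
have SC : ~` S = [set z | exists i j, [/\ P i j, A i z.1 & B j z.2]].
  apply/seteqP; split => z.
    rewrite /S /= -existsNP => -[i] /existsNP[j] /not_implyP[Pij].
    by move=> /not_implyP[Ai /contrapT Bj]; exists i, j.
  by move=> [i [j [Pij Ai Bj]]] /(_ i j Pij Ai).
have cS : dclosed (dprod dX dY) S.
  by rewrite /dclosed SC; apply: dopen_bigcup_rect.
have mSc : measurable (~` S : set T) by exact: sub_sigma_algebra.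
have piS : (1 - pi S <= e%:E)%E.
  rewrite -probability_setC; last by rewrite -[S]setCK; apply: measurableC.
  by rewrite SC piE.
(* An empty [S] forces [1 <= e], and then a single point does as well. *)
have [S0|/set0P S0] := eqVneq S set0.
  exists pi, [set point]; split => //; first exact: dclosed_point.
  have e_ge1 : (1%:E <= e%:E :> \bar R)%E by move: piS; rewrite S0 measure0 sube0.
  rewrite boxE ge_max; apply/andP; split.
    apply: le_trans e_ge1; rewrite leeBlDr ?leeDl //.
    apply: fin_num_measure; rewrite -[X in measurable X]setCK.
    by apply: measurableC; apply: sub_sigma_algebra; exact: dclosed_point.
  apply: dis_le; first by exists point.
  by move=> _ _ -> ->; rewrite (proj1 dmX _ _).2 // (proj1 dmY _ _).2 // subrr normr0.
exists pi, S; split => //; rewrite boxE ge_max piS /=.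
apply: dis_le => // p p' Sp Sp'.
apply/ler_addgt0Pr => r r0.
(* Five errors are added: one in each of the two coordinates of [p] and [p'], and [1 / (n + 1)] from
   the approximate optimality. *)
have r5 : 0 < r / 5 by lra.
(* A small rectangle around a point of [S] is not forbidden, and since [U] is an ultrafilter it is
   then hit for [U]-almost all [n]. *)
have hit z : S z -> exists i j, [/\ A i z.1, B j z.2,
    (forall x, A i x -> dX z.1 x < r / 5) & (forall y, B j y -> dY z.2 y < r / 5)]
    /\ U (~` miss i j).
  move=> Sz; have [i Ai iA] := bA.2 z.1 _ r5; have [j Bj jB] := bB.2 z.2 _ r5.
  exists i, j; split; first by split => // [x|y]; [apply: iA|apply: jB].
  have [Pij|//] := in_ultra_setVsetC (miss i j) ultraU.
  by case: (Sz i j Pij Ai).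
have [i [j [[Ai Bj iA jB] Uij]]] := hit _ Sp.
have [i' [j' [[Ai' Bj' iA' jB'] Uij']]] := hit _ Sp'.
(* One index serves both rectangles, so the distortion bound on [I0 n] compares the two hits. *)
have [n [[nij nij'] nr]] := filter_ex (filterI (filterI Uij Uij') (Ueps _ r5)).
have miss_ex k l : (~` miss k l) n ->
    exists t, [/\ I0 n t, A k (phi n t) & B l (psi n t)].
  move=> /existsNP[t] /not_implyP[It] /not_implyP[At /contrapT Bt].
  by exists t.
have [s [Is As Bs]] := miss_ex _ _ nij; have [t [It At Bt]] := miss_ex _ _ nij'.
have [_ _ _ /(_ s t Is It)] := par n.
have := iA _ As; have := jB _ Bs; have := iA' _ At; have := jB' _ Bt.
have [_ [symX triX]] := dmX; have [_ [symY triY]] := dmY.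
have := triX p.1 (phi n s) p'.1; have := triX (phi n s) (phi n t) p'.1.
have := triX (phi n s) p.1 (phi n t); have := triX p.1 p'.1 (phi n t).
have := triY p.2 (psi n s) p'.2; have := triY (psi n s) (psi n t) p'.2.
have := triY (psi n s) p.2 (psi n t); have := triY p.2 p'.2 (psi n t).
rewrite (symX (phi n t) p'.1) (symY (psi n t) p'.2).
rewrite (symX (phi n s) p.1) (symY (psi n s) p.2).
move: nr; rewrite /=; move: (n.+1%:R^-1) => x xr.
rewrite !ler_norml => *; apply/andP; split; lra.
Qed.

End Attained.

Theorem theorem1p1 (R : realType) (X Y : pointedType)
    (dX : X -> X -> R) (dY : Y -> Y -> R)
    (hX : complete_separable_metric dX) (hY : complete_separable_metric dY)
    (mX : probability (Borel dX) R) (mY : probability (Borel dY) R) :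
  (exists (pi : probability (Borel (dprod dX dY)) R) (S : set (X * Y)),
      [/\ transport_plan mX mY pi, dclosed (dprod dX dY) S &
          box mX mY = maxe (1 - pi S)%E (dis dX dY S)]) /\
  (forall (pi : probability (Borel (dprod dX dY)) R) (S : set (X * Y)),
      transport_plan mX mY pi -> dclosed (dprod dX dY) S ->
      (box mX mY <= maxe (1 - pi S)%E (dis dX dY S))%E).
Proof.
split; last by move=> pi S; exact: box_le_plan.
have [pi [S [piP cS boxS]]] := box_attained hX hY mX mY.
exists pi, S; split => //; apply/eqP; rewrite eq_le boxS andbT.
exact: box_le_plan.
Qed.
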